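(* Let $A\in\mathbb{R}^{m\times n}$, $y\in\mathbb{R}^m$, let $k\ge 1$ be an integer and let $q$ be an integer with $2k\le q\le n$. Let $x^*\in\mathbb{R}^n$ be a (global) solution of $$\min_{x\in\mathbb{R}^n}\left\{\tfrac12\|y-Ax\|_2^2 : \|x\|_0\le k\right\},$$ and let $\eta:=y-Ax^*$. Suppose the restricted isometry constant of $A$ satisfies $\delta_{3k}<\beta^*$, where $\beta^*$ is the unique real root in $(0,1)$ of the equation $$9\left(\left\lceil \tfrac{q}{k}\right\rceil+1\right)^2\beta^3+9\left(\left\lceil \tfrac{q}{k}\right\rceil+1\right)^2\beta^2+\frac{2}{7+3\sqrt5}\,\beta-\frac{2}{7+3\sqrt5}=0 .$$ Then the sequence $\{x^p\}_{p\ge 0}$ generated by the PGROT algorithm satisfies, for all $p\ge 0$, $$\|x^{p+1}-x^*\|_2\le \overline{\rho}^{\,p}\|x^0-x^*\|_2+\frac{\overline{\tau}}{1-\overline{\rho}}\|\eta\|_2,$$ where $$\overline{\rho}:=3\left(\frac{\sqrt5+1}{2}\right)^2\left(\left\lceil \tfrac{q}{k}\right\rceil+1\right)\delta_{3k}\sqrt{\frac{1+\delta_k}{1-\delta_{2k}}}<1$$ (the inequality $\overline{\rho}<1$ being ensured by the condition $\delta_{3k}<\beta^*$) and $$\overline{\tau}:=\left(\frac{\sqrt5+1}{2}\right)^2\frac{3\left(\left\lceil \frac{q}{k}\right\rceil+1\right)(1+\delta_k)}{\sqrt{1-\delta_{2k}}}+\frac{\sqrt5+1}{\sqrt{1-\delta_{2k}}}.$$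 In particular, if $\eta=0$, the sequence $\{x^p\}$ generated by PGROT converges to $x^*$.
   Context: $\|x\|_0$ is the number of nonzero entries of $x$; $x$ is $s$-sparse if $\|x\|_0\le s$. $\lceil\cdot\rceil$ is the ceiling function, $\mathbf{e}\in\mathbb{R}^n$ is the vector of ones, $\otimes$ is the entrywise (Hadamard) product of vectors, and vector inequalities are entrywise. Restricted isometry constant: for an integer $s>0$, $\delta_s$ is the smallest number $\delta_s\ge 0$ such that $(1-\delta_s)\|x\|_2^2\le\|Ax\|_2^2\le(1+\delta_s)\|x\|_2^2$ for all $s$-sparse $x\in\mathbb{R}^n$. Hard thresholding: for an integer $r$, $\mathcal{H}_r(z)$ retains the $r$ entries of $z$ of largest magnitude and sets all other entries to zero (ties broken arbitrarily). PGROT algorithm (partial gradient relaxed optimal $k$-thresholding), with inputs $A,y,k,q$: start from $x^0=0$ and for $p=0,1,2,\dots$ set $u^p=x^p+\mathcal{H}_q\left(A^T(y-Ax^p)\right)$; $\overline{w}^p\in\arg\min_w\{\|y-A(w\otimes u^p)\|_2^2:\ \mathbf{e}^Tw=k,\ 0\le w\le\mathbf{e}\}$ (any minimizer); $x^{p+1}=\mathcal{H}_k(\overline{w}^p\otimes u^p)$. *)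

(* Defs.v *)
From HB Require Import structures.
From mathcomp Require Import all_boot all_order all_algebra.
From mathcomp Require Import all_classical all_reals all_analysis.
From mathcomp Require Import ring lra.
Set Implicit Arguments.
Unset Strict Implicit.
Unset Printing Implicit Defensive.
Import Order.TTheory GRing.Theory Num.Theory.
Import numFieldNormedType.Exports.
Local Open Scope classical_set_scope.
Local Open Scope ring_scope.

(* The norm [`|x|] provided by the library on matrices is the sup norm. *)
Definition l2norm (R : realType) (n : nat) (x : 'cV[R]_n) : R :=
  Num.sqrt (\sum_i x i 0 ^+ 2).

Definition nnz (R : realType) (n : nat) (x : 'cV[R]_n) : nat :=
  #|[set i | x i 0 != 0]%SET|.

Definition sparse (R : realType) (n s : nat) (x : 'cV[R]_n) : bool :=
  (nnz x <= s)%N.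

Definition hadamard (R : realType) (n : nat) (x y : 'cV[R]_n) : 'cV[R]_n :=
  map2_mx *%R x y.

Definition rip (R : realType) (m n : nat) (A : 'M[R]_(m, n)) (s : nat)
    (d : R) : Prop :=
  0 <= d /\ forall x : 'cV[R]_n, sparse s x ->
    (1 - d) * l2norm x ^+ 2 <= l2norm (A *m x) ^+ 2 <= (1 + d) * l2norm x ^+ 2.

(* The infimum is attained: see [ric_smallest]. *)
Definition ric (R : realType) (m n : nat) (A : 'M[R]_(m, n)) (s : nat) : R :=
  inf [set d | rip A s d].

Lemma sqr_l2norm (R : realType) (n : nat) (x : 'cV[R]_n) :
  l2norm x ^+ 2 = \sum_i x i 0 ^+ 2.
Proof. by rewrite sqr_sqrtr // sumr_ge0 // => i _; rewrite sqr_ge0. Qed.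

Lemma rip_ex (R : realType) (m n : nat) (A : 'M[R]_(m, n)) (s : nat) :
  exists d, rip A s d.
Proof.
pose C := \sum_i (\sum_j `|A i j|) ^+ 2.
have C0 : 0 <= C by rewrite sumr_ge0 // => i _; rewrite sqr_ge0.
exists (1 + C); split=> [|x _]; first by rewrite addr_ge0.
have AC : l2norm (A *m x) ^+ 2 <= C * l2norm x ^+ 2.
  rewrite [leLHS]sqr_l2norm /C mulr_suml ler_sum // => i _.
  rewrite mxE -exprMn -real_normK ?num_real //.
  have N0 : 0 <= l2norm x by exact: sqrtr_ge0.
  have S0 : 0 <= \sum_j `|A i j| by rewrite sumr_ge0.
  rewrite ler_sqr ?nnegrE ?normr_ge0 ?mulr_ge0 //.
  apply: (le_trans (ler_norm_sum _ _ _)).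
  rewrite mulr_suml ler_sum // => j _; rewrite normrM ler_wpM2l //.
  rewrite -ler_sqr ?nnegrE // real_normK ?num_real // sqr_l2norm.
  by rewrite (bigD1 j) //= lerDl sumr_ge0 // => l _; rewrite sqr_ge0.
have Y0 : 0 <= l2norm (A *m x) ^+ 2 by exact: sqr_ge0.
have X0 : 0 <= l2norm x ^+ 2 by exact: sqr_ge0.
by apply/andP; split; nra.
Qed.

Lemma ric_smallest (R : realType) (m n : nat) (A : 'M[R]_(m, n)) (s : nat) :
  rip A s (ric A s) /\ forall d, rip A s d -> ric A s <= d.
Proof.
have lbE : has_lbound [set d | rip A s d] by exists 0 => d [].
have neE : [set d | rip A s d] !=set0 by have [d] := rip_ex A s; exists d.
split; last by move=> d dE; apply: ge_inf.
split; first by apply: lb_le_inf => // d [].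
move=> x xs; have X0 : 0 <= l2norm x ^+ 2 by exact: sqr_ge0.
have [d0 [_ /(_ x xs) Hd0]] := neE.
have [X1|X1] := eqVneq (l2norm x ^+ 2) 0.
  by move: Hd0; rewrite X1 !mulr0.
have {}X0 : 0 < l2norm x ^+ 2 by rewrite lt_def X1.
apply/andP; split.
- rewrite mulrBl mul1r lerBlDl -lerBlDr -ler_pdivrMr //.
  apply: lb_le_inf => // d [_ /(_ x xs)/andP[H _]].
  by rewrite ler_pdivrMr //; lra.
- rewrite mulrDl mul1r -lerBlDl -ler_pdivrMr //.
  apply: lb_le_inf => // d [_ /(_ x xs)/andP[_ H]].
  by rewrite ler_pdivrMr //; lra.
Qed.

(* [v] is an admissible value of H_r(z); any choice of the [r] retained entries
   is allowed in the presence of ties.  No [v] is admissible when [n < r]. *)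
Definition is_hard_threshold (R : realType) (n r : nat) (z v : 'cV[R]_n) :
    Prop :=
  exists S : {set 'I_n},
    [/\ #|S| = r,
        forall i j, i \in S -> j \notin S -> `|z j 0| <= `|z i 0|
      & v = \col_i (if i \in S then z i 0 else 0)].

Definition relaxed_weight (R : realType) (n k : nat) (w : 'cV[R]_n) : Prop :=
  \sum_i w i 0 = k%:R /\ forall i, 0 <= w i 0 <= 1.

Definition is_optimal_weight (R : realType) (m n : nat) (A : 'M[R]_(m, n))
    (y : 'cV[R]_m) (k : nat) (u w : 'cV[R]_n) : Prop :=
  relaxed_weight k w /\ forall w', relaxed_weight k w' ->
    l2norm (y - A *m hadamard w u) ^+ 2 <= l2norm (y - A *m hadamard w' u) ^+ 2.

(* [x] is a sequence that the algorithm may produce, for some resolution of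
   the ties and some choice of the minimizers. *)
Definition is_PGROT (R : realType) (m n : nat) (A : 'M[R]_(m, n))
    (y : 'cV[R]_m) (k q : nat) (x : nat -> 'cV[R]_n) : Prop :=
  x 0%N = 0 /\
  forall p, exists v u w : 'cV[R]_n,
    [/\ is_hard_threshold q (A^T *m (y - A *m x p)) v,
        u = x p + v,
        is_optimal_weight A y k u w
      & is_hard_threshold k (hadamard w u) (x p.+1)].

Definition is_sparse_ls_solution (R : realType) (m n : nat) (A : 'M[R]_(m, n))
    (y : 'cV[R]_m) (k : nat) (xs : 'cV[R]_n) : Prop :=
  (nnz xs <= k)%N /\ forall x : 'cV[R]_n, (nnz x <= k)%N ->
    2^-1 * l2norm (y - A *m xs) ^+ 2 <= 2^-1 * l2norm (y - A *m x) ^+ 2.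

Definition ceil_ratio (R : realType) (q k : nat) : R :=
  (Num.ceil (q%:R / k%:R : R))%:~R.

Definition is_beta_root (R : realType) (q k : nat) (b : R) : Prop :=
  0 < b < 1 /\
  9 * (ceil_ratio R q k + 1) ^+ 2 * b ^+ 3
  + 9 * (ceil_ratio R q k + 1) ^+ 2 * b ^+ 2
  + 2 / (7 + 3 * Num.sqrt 5) * b - 2 / (7 + 3 * Num.sqrt 5) = 0.

Definition rho_bar (R : realType) (m n : nat) (A : 'M[R]_(m, n)) (q k : nat) :
    R :=
  3 * ((Num.sqrt 5 + 1) / 2) ^+ 2 * (ceil_ratio R q k + 1) * ric A (3 * k)
  * Num.sqrt ((1 + ric A k) / (1 - ric A (2 * k))).

Definition tau_bar (R : realType) (m n : nat) (A : 'M[R]_(m, n)) (q k : nat) :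
    R :=
  ((Num.sqrt 5 + 1) / 2) ^+ 2
  * (3 * (ceil_ratio R q k + 1) * (1 + ric A k) / Num.sqrt (1 - ric A (2 * k)))
  + (Num.sqrt 5 + 1) / Num.sqrt (1 - ric A (2 * k)).

(* Main.v *)
Require Import Defs.
From HB Require Import structures.
From mathcomp Require Import all_boot all_order all_algebra.
From mathcomp Require Import all_classical all_reals all_analysis.
From mathcomp Require Import ring lra.
Set Implicit Arguments.
Unset Strict Implicit.
Unset Printing Implicit Defensive.
Import Order.TTheory GRing.Theory Num.Theory.
Import numFieldNormedType.Exports.
Local Open Scope classical_set_scope.
Local Open Scope ring_scope.

(* Write phi for the golden ratio, d_s for the restricted isometry constant of
   order s, c for the ceiling of q / k, and e := u^p - xs.

   Hard thresholding approximates a sparse vector within a factor phi of the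
   error of its input on the union of the two supports.  Applied to H_q, with
   the support of size at most q + 2k split into c + 2 blocks of size at most k,
   this gives |e| <= phi (c + 2) (d_3k |x^p - xs| + sqrt(1 + d_k) |eta|).

   A relaxed weight is a convex combination of indicators of k-element sets, so
   |A (w * z)| <= sqrt(1 + d_k) |z| for every z, even though w * z need not be
   sparse.  Comparing the optimal weight w with the indicator of a k-element set
   containing the support of xs bounds |y - A (w * u)| by
   |eta| + sqrt(1 + d_k) |e|.  With Om the union of that set and the set kept by
   H_k, moving the part of w * u outside Om to the other side yields
   sqrt(1 - d_2k) |(w * u - xs)_Om| <= 2 |eta| + 2 sqrt(1 + d_k) |e|.

   Applying the golden ratio bound to H_k and using 2 (c + 2) <= 3 (c + 1) gives
   the one-step contraction with the constants rho and tau. *)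

(** * Inner product and Euclidean norm *)

Definition dotv (R : realType) (n : nat) (a b : 'cV[R]_n) : R :=
  (a^T *m b) 0 0.

Definition restr (R : realType) (n : nat) (S : {set 'I_n}) (z : 'cV[R]_n) :
    'cV[R]_n :=
  \col_i (if i \in S then z i 0 else 0).

Definition golden (R : realType) : R := (Num.sqrt 5 + 1) / 2.

Lemma dotvE (R : realType) (n : nat) (a b : 'cV[R]_n) :
  dotv a b = \sum_i a i 0 * b i 0.
Proof. by rewrite /dotv mxE; apply: eq_bigr => i _; rewrite mxE. Qed.

Lemma dotvC (R : realType) (n : nat) (a b : 'cV[R]_n) : dotv a b = dotv b a.
Proof. by rewrite !dotvE; apply: eq_bigr => i _; rewrite mulrC. Qed.

Lemma dotvDr (R : realType) (n : nat) (a b c : 'cV[R]_n) :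
  dotv a (b + c) = dotv a b + dotv a c.
Proof. by rewrite /dotv mulmxDr mxE. Qed.

Lemma dotvZr (R : realType) (n : nat) (t : R) (a b : 'cV[R]_n) :
  dotv a (t *: b) = t * dotv a b.
Proof. by rewrite /dotv -scalemxAr mxE. Qed.

Lemma dotvDl (R : realType) (n : nat) (a b c : 'cV[R]_n) :
  dotv (b + c) a = dotv b a + dotv c a.
Proof. by rewrite !(dotvC _ a) dotvDr. Qed.

Lemma dotvZl (R : realType) (n : nat) (t : R) (a b : 'cV[R]_n) :
  dotv (t *: b) a = t * dotv b a.
Proof. by rewrite !(dotvC _ a) dotvZr. Qed.

Lemma dotvBr (R : realType) (n : nat) (a b c : 'cV[R]_n) :
  dotv a (b - c) = dotv a b - dotv a c.
Proof. by rewrite dotvDr -scaleN1r dotvZr mulN1r. Qed.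

Lemma dotv0r (R : realType) (n : nat) (a : 'cV[R]_n) : dotv a 0 = 0.
Proof. by rewrite /dotv mulmx0 mxE. Qed.

Lemma dotv0l (R : realType) (n : nat) (a : 'cV[R]_n) : dotv 0 a = 0.
Proof. by rewrite dotvC dotv0r. Qed.

Lemma dotv_trmx (R : realType) (m n : nat) (A : 'M[R]_(m, n)) (a : 'cV[R]_n)
    (b : 'cV[R]_m) :
  dotv a (A^T *m b) = dotv (A *m a) b.
Proof. by rewrite /dotv trmx_mul mulmxA. Qed.

Lemma sqr_l2norm_dotv (R : realType) (n : nat) (a : 'cV[R]_n) :
  l2norm a ^+ 2 = dotv a a.
Proof. by rewrite sqr_l2norm dotvE; apply: eq_bigr => i _; rewrite expr2. Qed.

Lemma l2norm_ge0 (R : realType) (n : nat) (a : 'cV[R]_n) : 0 <= l2norm a.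
Proof. exact: sqrtr_ge0. Qed.

Lemma l2normZ (R : realType) (n : nat) (t : R) (a : 'cV[R]_n) :
  0 <= t -> l2norm (t *: a) = t * l2norm a.
Proof.
move=> t0; apply: (pexpIrn (n := 2)) => //.
- by rewrite nnegrE l2norm_ge0.
- by rewrite nnegrE mulr_ge0 ?l2norm_ge0.
by rewrite exprMn !sqr_l2norm_dotv dotvZl dotvZr mulrA expr2.
Qed.

Lemma l2normN (R : realType) (n : nat) (a : 'cV[R]_n) : l2norm (- a) = l2norm a.
Proof.
by congr Num.sqrt; apply: eq_bigr => i _; rewrite mxE sqrrN.
Qed.

Lemma l2norm0_eq0 (R : realType) (n : nat) (a : 'cV[R]_n) :
  l2norm a = 0 -> a = 0.
Proof.
move=> /(congr1 (fun t => t ^+ 2)); rewrite sqr_l2norm expr0n /= => /eqP.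
rewrite psumr_eq0 => [/allP H|i _]; last exact: sqr_ge0.
apply/matrixP => i j; rewrite ord1 mxE.
by have := H i (mem_index_enum _); rewrite /= sqrf_eq0 => /eqP.
Qed.

Lemma l2norm0 (R : realType) (n : nat) : l2norm (0 : 'cV[R]_n) = 0.
Proof. by rewrite -(scale0r 0) l2normZ ?mul0r. Qed.

(** Cauchy-Schwarz, from the nonnegative squared norm of [l2norm b *: a - l2norm a *: b]; the null
    cases are split off so that the product of the norms can be cancelled. *)
Lemma dotv_le_l2norm (R : realType) (n : nat) (a b : 'cV[R]_n) :
  dotv a b <= l2norm a * l2norm b.
Proof.
have [/l2norm0_eq0 ->|a0] := eqVneq (l2norm a) 0.
  by rewrite l2norm0 mul0r dotv0l.
have [/l2norm0_eq0 ->|b0] := eqVneq (l2norm b) 0.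
  by rewrite l2norm0 mulr0 dotv0r.
have ab : 0 < l2norm a * l2norm b by rewrite mulr_gt0 // lt_def l2norm_ge0 ?a0 ?b0.
have : 0 <= l2norm (l2norm b *: a + (- l2norm a) *: b) ^+ 2 by exact: sqr_ge0.
rewrite sqr_l2norm_dotv !(dotvDl, dotvDr, dotvZl, dotvZr) (dotvC b a).
rewrite -!sqr_l2norm_dotv => H.
rewrite -(ler_pM2l ab); nra.
Qed.

Lemma l2normD (R : realType) (n : nat) (a b : 'cV[R]_n) :
  l2norm (a + b) <= l2norm a + l2norm b.
Proof.
rewrite -ler_sqr ?nnegrE ?addr_ge0 ?l2norm_ge0 //.
rewrite sqr_l2norm_dotv !(dotvDl, dotvDr) (dotvC b a) sqrrD -!sqr_l2norm_dotv.
have := dotv_le_l2norm a b; lra.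
Qed.

Lemma l2normB (R : realType) (n : nat) (a b : 'cV[R]_n) :
  l2norm (a - b) <= l2norm a + l2norm b.
Proof. by rewrite -(l2normN b) l2normD. Qed.

(** * Restriction to an index set and counting of nonzero entries *)

Lemma restrD (R : realType) (n : nat) (S : {set 'I_n}) (a b : 'cV[R]_n) :
  restr S (a + b) = restr S a + restr S b.
Proof.
apply/matrixP => i j; rewrite !mxE.
by case: ifP => // _; rewrite addr0.
Qed.

Lemma l2norm_restr_le (R : realType) (n : nat) (S : {set 'I_n})
    (a : 'cV[R]_n) :
  l2norm (restr S a) <= l2norm a.
Proof.
rewrite ler_wsqrtr // ler_sum // => i _; rewrite mxE.
by case: ifP => // _; rewrite expr0n sqr_ge0.
Qed.

Lemma dotv_restr (R : realType) (n : nat) (S : {set 'I_n}) (a : 'cV[R]_n) :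
  dotv (restr S a) a = l2norm (restr S a) ^+ 2.
Proof.
rewrite sqr_l2norm dotvE; apply: eq_bigr => i _; rewrite mxE.
by case: ifP => _; rewrite ?mul0r ?expr0n // expr2.
Qed.

Lemma nnz_le_card (R : realType) (n : nat) (S : {set 'I_n}) (a : 'cV[R]_n) :
  (forall i, i \notin S -> a i 0 = 0) -> (nnz a <= #|S|)%N.
Proof.
move=> H; apply/subset_leq_card/fintype.subsetP => i; rewrite inE.
by apply: contraR => /H ->.
Qed.

Lemma nnzD (R : realType) (n : nat) (a b : 'cV[R]_n) :
  (nnz (a + b) <= nnz a + nnz b)%N.
Proof.
apply: leq_trans (leq_card_setU _ _).
apply: nnz_le_card => i; rewrite !inE negb_or !negbK mxE.
by move=> /andP[/eqP-> /eqP->]; rewrite addr0.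
Qed.

Lemma nnzZ (R : realType) (n : nat) (t : R) (a : 'cV[R]_n) :
  (nnz (t *: a) <= nnz a)%N.
Proof.
apply: nnz_le_card => i; rewrite !inE negbK mxE.
by move=> /eqP->; rewrite mulr0.
Qed.

Lemma nnzB (R : realType) (n : nat) (a b : 'cV[R]_n) :
  (nnz (a - b) <= nnz a + nnz b)%N.
Proof.
by apply: leq_trans (nnzD _ _) _; rewrite leq_add2l -scaleN1r nnzZ.
Qed.

Lemma nnz_restr (R : realType) (n : nat) (S : {set 'I_n}) (a : 'cV[R]_n) :
  (nnz (restr S a) <= #|S|)%N.
Proof. by apply: nnz_le_card => i /negPf; rewrite mxE => ->. Qed.

(** * Consequences of the restricted isometry property *)

Lemma ric_ge0 (R : realType) (m n : nat) (A : 'M[R]_(m, n)) (s : nat) :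
  0 <= ric A s.
Proof. by have [[]] := ric_smallest A s. Qed.

Lemma ric_mono (R : realType) (m n : nat) (A : 'M[R]_(m, n)) (s t : nat) :
  (s <= t)%N -> ric A s <= ric A t.
Proof.
move=> st; have [[d0 H] _] := ric_smallest A t.
apply: (ric_smallest A s).2; split=> // x xs.
exact/H/(leq_trans xs).
Qed.

Lemma ric_ub (R : realType) (m n : nat) (A : 'M[R]_(m, n)) (s : nat)
    (a : 'cV[R]_n) :
  (nnz a <= s)%N -> l2norm (A *m a) <= Num.sqrt (1 + ric A s) * l2norm a.
Proof.
move=> sa; have [[d0 /(_ a sa)/andP[_ H]] _] := ric_smallest A s.
rewrite -ler_sqr ?nnegrE ?mulr_ge0 ?sqrtr_ge0 ?l2norm_ge0 //.
by rewrite exprMn [Num.sqrt (1 + _) ^+ 2]sqr_sqrtr // addr_ge0.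
Qed.

Lemma ric_lb (R : realType) (m n : nat) (A : 'M[R]_(m, n)) (s : nat)
    (a : 'cV[R]_n) :
  (nnz a <= s)%N -> ric A s <= 1 ->
  Num.sqrt (1 - ric A s) * l2norm a <= l2norm (A *m a).
Proof.
move=> sa d1; have [[d0 /(_ a sa)/andP[H _]] _] := ric_smallest A s.
rewrite -ler_sqr ?nnegrE ?mulr_ge0 ?sqrtr_ge0 ?l2norm_ge0 //.
by rewrite exprMn [Num.sqrt (1 - _) ^+ 2]sqr_sqrtr // subr_ge0.
Qed.

(* Polarization at [a + b] and [a - b]. *)
Lemma ric_dotv_sum (R : realType) (m n : nat) (A : 'M[R]_(m, n)) (s : nat)
    (a b : 'cV[R]_n) :
  (nnz a + nnz b <= s)%N ->
  2 * (dotv (A *m a) (A *m b) - dotv a b)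
  <= ric A s * (l2norm a ^+ 2 + l2norm b ^+ 2).
Proof.
move=> sab; have [[d0 H] _] := ric_smallest A s.
have /andP[_ H1] := H (a + b) (leq_trans (nnzD _ _) sab).
have /andP[H2 _] := H (a - b) (leq_trans (nnzB _ _) sab).
move: H1 H2; rewrite -[- b]scaleN1r !mulmxDr -scalemxAr !sqr_l2norm_dotv.
rewrite !(dotvDl, dotvDr, dotvZl, dotvZr) (dotvC (A *m b) (A *m a)) (dotvC b a).
lra.
Qed.

(** Rescaling to [l2norm b *: a] and [l2norm a *: b] gives both vectors the same norm, which turns
    the sum of squares in [ric_dotv_sum] into twice a product. *)
Lemma ric_dotv (R : realType) (m n : nat) (A : 'M[R]_(m, n)) (s : nat)
    (a b : 'cV[R]_n) :
  (nnz a + nnz b <= s)%N ->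
  dotv (A *m a) (A *m b) - dotv a b <= ric A s * (l2norm a * l2norm b).
Proof.
move=> sab.
have [/l2norm0_eq0 ->|a0] := eqVneq (l2norm a) 0.
  by rewrite mulmx0 l2norm0 mul0r mulr0 !dotv0l subrr.
have [/l2norm0_eq0 ->|b0] := eqVneq (l2norm b) 0.
  by rewrite mulmx0 l2norm0 !mulr0 !dotv0r subrr.
have ab : 0 < l2norm a * l2norm b by rewrite mulr_gt0 // lt_def l2norm_ge0 ?a0 ?b0.
have := @ric_dotv_sum _ _ _ A s (l2norm b *: a) (l2norm a *: b).
have nn := leq_trans (leq_add (nnzZ (l2norm b) a) (nnzZ (l2norm a) b)) sab.
move=> /(_ nn).
rewrite -!scalemxAr !(dotvZl, dotvZr) !l2normZ ?l2norm_ge0 // => H.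
rewrite -(ler_pM2l ab); lra.
Qed.

(** Near-isometry makes [A^T *m A - 1] small when seen through few coordinates. The restricted
    vector is tested against itself, and one factor of its norm is cancelled. *)
Lemma l2norm_restr_gram (R : realType) (m n : nat) (A : 'M[R]_(m, n))
    (s : nat) (B : {set 'I_n}) (d : 'cV[R]_n) :
  (#|B| + nnz d <= s)%N ->
  l2norm (restr B (A^T *m (A *m d) - d)) <= ric A s * l2norm d.
Proof.
move=> sB; set r := _ - d.
have [->|r0] := eqVneq (l2norm (restr B r)) 0.
  by rewrite mulr_ge0 ?ric_ge0 ?l2norm_ge0.
have r0' : 0 < l2norm (restr B r) by rewrite lt_def r0 l2norm_ge0.
rewrite -(ler_pM2l r0') -expr2 -dotv_restr {2}/r dotvBr dotv_trmx.
rewrite mulrCA; apply: ric_dotv; apply: leq_trans sB.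
by rewrite leq_add2r nnz_restr.
Qed.

(** By duality: testing the restriction against itself moves [A] onto a sparse vector, where the
    upper isometry bound applies. *)
Lemma l2norm_restr_trmx (R : realType) (m n : nat) (A : 'M[R]_(m, n))
    (s : nat) (B : {set 'I_n}) (e : 'cV[R]_m) :
  (#|B| <= s)%N ->
  l2norm (restr B (A^T *m e)) <= Num.sqrt (1 + ric A s) * l2norm e.
Proof.
move=> sB; set r := A^T *m e.
have [->|r0] := eqVneq (l2norm (restr B r)) 0.
  by rewrite mulr_ge0 ?sqrtr_ge0 ?l2norm_ge0.
have r0' : 0 < l2norm (restr B r) by rewrite lt_def r0 l2norm_ge0.
rewrite -(ler_pM2l r0') -expr2 -dotv_restr {2}/r dotv_trmx.
apply: le_trans (dotv_le_l2norm _ _) _.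
rewrite mulrCA mulrA ler_wpM2r ?l2norm_ge0 //.
by rewrite ric_ub // (leq_trans (nnz_restr _ _)).
Qed.

(** * The golden ratio bound for hard thresholding *)

Lemma golden_gt1 (R : realType) : 1 < golden R.
Proof.
have : 1 < Num.sqrt (5 : R) by rewrite -{1}sqrtr1 ltr_sqrt; lra.
by rewrite /golden; lra.
Qed.

Lemma golden_sqr (R : realType) : golden R ^+ 2 = golden R + 1.
Proof.
have : Num.sqrt (5 : R) ^+ 2 = 5 by rewrite sqr_sqrtr; lra.
by rewrite /golden; nra.
Qed.

(** Double counting: summing the comparison over all pairs gives [#|C|] times the left side at most
    [#|B|] times the right side. *)
Lemma sum_dominated (R : realType) (I : finType) (B C : {set I}) (f : I -> R) :
  (forall i, 0 <= f i) -> (#|B| <= #|C|)%N ->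
  (forall i j, i \in B -> j \in C -> f i <= f j) ->
  \sum_(i in B) f i <= \sum_(j in C) f j.
Proof.
move=> f0 BC H; have [C0|C0] := posnP #|C|.
  move: BC; rewrite C0 leqn0 => /eqP/cards0_eq ->.
  by rewrite big_set0 sumr_ge0.
have C0' : 0 < #|C|%:R :> R by rewrite ltr0n.
rewrite -(ler_pM2l C0').
apply: (@le_trans _ _ (#|B|%:R * \sum_(j in C) f j)); last first.
  by rewrite ler_wpM2r ?sumr_ge0 // ler_nat.
rewrite mulr_sumr [leRHS]mulr_natl -[leRHS]sumr_const ler_sum // => i iB.
by rewrite mulr_natl -sumr_const ler_sum // => j jC; exact: H.
Qed.

(** Multiplied by [golden R], the difference of the two sides is the perfect square of
    [golden R * (t - s) + t]. *)
Lemma golden_young (R : realType) (s t : R) :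
  s ^+ 2 <= golden R ^+ 2 * (t - s) ^+ 2 + golden R * t ^+ 2.
Proof.
have g1 := golden_gt1 R; have g2 := golden_sqr R.
have g0 : 0 < golden R by lra.
rewrite -subr_ge0 -(pmulr_rge0 _ g0).
have -> : golden R * (golden R ^+ 2 * (t - s) ^+ 2 + golden R * t ^+ 2 - s ^+ 2)
  = (golden R * (t - s) + t) ^+ 2.
  ring: g2.
exact: sqr_ge0.
Qed.

(** The entries wrongly kept, on [T :\: D], carry at least the energy of those wrongly dropped, on
    [D :\: T]. Trading one for the other with weight [golden R] leaves an entrywise claim:
    [golden_young] settles the dropped entries, and the kept ones balance exactly because
    [golden R ^+ 2 - golden R = 1]. *)
Lemma hard_threshold_golden (R : realType) (n : nat) (T D : {set 'I_n})
    (z x : 'cV[R]_n) :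
  (#|D| <= #|T|)%N ->
  (forall i j, i \in T -> j \notin T -> `|z j 0| <= `|z i 0|) ->
  (forall i, i \notin D -> x i 0 = 0) ->
  l2norm (restr T z - x) <= golden R * l2norm (restr (T :|: D) (z - x)).
Proof.
move=> DT top xD; have g1 := golden_gt1 R; have g2 := golden_sqr R.
have g0 : 0 <= golden R by lra.
rewrite -ler_sqr ?nnegrE ?mulr_ge0 ?l2norm_ge0 //.
rewrite exprMn !sqr_l2norm mulr_sumr.
have swap : \sum_(i in D :\: T) z i 0 ^+ 2 <= \sum_(i in T :\: D) z i 0 ^+ 2.
  apply: sum_dominated => [i||i j]; first exact: sqr_ge0.
    by rewrite !cardsD finset.setIC leq_sub2r.
  rewrite !inE => /andP[iT _] /andP[_ jT].
  by rewrite -(real_normK (num_real (z i 0))) -(real_normK (num_real (z j 0)))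
    ler_sqr ?nnegrE // top.
suff : \sum_i (restr T z - x) i 0 ^+ 2 <=
    \sum_i golden R ^+ 2 * restr (T :|: D) (z - x) i 0 ^+ 2
    + golden R * \sum_(i in D :\: T) z i 0 ^+ 2
    - golden R * \sum_(i in T :\: D) z i 0 ^+ 2.
  by have := ler_wpM2l g0 swap; lra.
rewrite [\sum_(i in D :\: T) _]big_mkcond [\sum_(i in T :\: D) _]big_mkcond /=.
rewrite !mulr_sumr -big_split -sumrB ler_sum // => i _; rewrite !mxE !inE /=.
have := golden_young (x i 0) (z i 0).
rewrite g2; case: (boolP (i \in T)) => iT; case: (boolP (i \in D)) => iD /=.
- by move=> _; have := mulr_ge0 g0 (sqr_ge0 (z i 0 - x i 0)); lra.
- by rewrite (xD i iD); lra.
- lra.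
- by rewrite (xD i iD); lra.
Qed.

(** * Sets of prescribed size and splitting into blocks *)

Lemma subset_of_card (T : finType) (D : {set T}) (j : nat) :
  (j <= #|D|)%N -> exists2 B : {set T}, B \subset D & #|B| = j.
Proof.
move=> jD; have : (0 < #|[set B : {set T} | (B \subset D) && (#|B| == j)]%SET|)%N.
  by rewrite cards_draws bin_gt0.
by case/card_gt0P => B; rewrite inE => /andP[BD /eqP Bj]; exists B.
Qed.

Lemma superset_of_card (T : finType) (D : {set T}) (j : nat) :
  (#|D| <= j <= #|T|)%N -> exists2 B : {set T}, D \subset B & #|B| = j.
Proof.
move=> /andP[Dj jT].
have [|B BD Bj] := @subset_of_card T (~: D) (#|T| - j)%N.
  by rewrite cardsCs finset.setCK leq_sub2l.
exists (~: B); first by rewrite -finset.setCS finset.setCK.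
by rewrite cardsCs finset.setCK Bj subKn.
Qed.

(** Blocks of at most [k] indices are peeled off one by one, each paid for by the triangle
    inequality. This allows restricted isometry constants of low order on a large set. *)
Lemma l2norm_restr_blocks (R : realType) (n k N : nat) (c : R)
    (z : 'cV[R]_n) (D : {set 'I_n}) :
  (forall B : {set 'I_n}, (#|B| <= k)%N -> l2norm (restr B z) <= c) ->
  (#|D| <= N * k)%N -> l2norm (restr D z) <= N%:R * c.
Proof.
move=> Hc; elim: N D => [|N IH] D DN.
  move: DN; rewrite mul0n leqn0 => /eqP/cards0_eq ->.
  have -> : restr finset.set0 z = 0.
    by apply/matrixP => i j; rewrite !mxE inE.
  by rewrite l2norm0 mul0r.
have [|B BD Bk] := @subset_of_card _ D (minn k #|D|); first exact: geq_minr.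
have -> : restr D z = restr B z + restr (D :\: B) z.
  apply/matrixP => i j; rewrite !mxE inE.
  case: (boolP (i \in B)) => [/(fintype.subsetP BD) ->|_] /=.
    by rewrite addr0.
  by rewrite add0r.
apply: le_trans (l2normD _ _) _; rewrite -natr1 mulrDl mul1r addrC lerD //.
  apply: IH; rewrite cardsDS // Bk leq_subLR minnC /minn.
  by case: ltnP => _; rewrite ?leq_addr // -mulSn.
by apply: Hc; rewrite Bk geq_minl.
Qed.

(** * The polytope of relaxed weights and its vertices *)

Definition fractional (R : realType) (n : nat) (w : 'cV[R]_n) : {set 'I_n} :=
  [set i | 0 < w i 0 < 1]%SET.

(** A direction of zero sum: moving along it transfers weight from [j] to [i]. *)
Definition exchange (R : realType) (n : nat) (i j : 'I_n) : 'cV[R]_n :=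
  \col_l ((l == i)%:R - (l == j)%:R).

(** The step [e] is the largest one that stays in the unit box: entry [i] reaches 1 or entry [j]
    reaches 0, so at least one of them stops being fractional while no other entry changes. *)
Lemma relaxed_weight_shift (R : realType) (n k : nat) (w : 'cV[R]_n)
    (i j : 'I_n) :
  relaxed_weight k w -> i \in fractional w -> j \in fractional w -> i != j ->
  exists e : R, [/\ 0 < e,
    relaxed_weight k (w + e *: exchange R i j) &
    (#|fractional (w + e *: exchange R i j)|
      < #|fractional w|)%N].
Proof.
move=> [ws w01]; rewrite !inE => /andP[wi0 wi1] /andP[wj0 wj1] ij.
pose e := Num.min (1 - w i 0) (w j 0).
have e0 : 0 < e by rewrite lt_min subr_gt0 wi1 wj0.
have ei : e <= 1 - w i 0 by rewrite ge_min lexx.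
have ej : e <= w j 0 by rewrite ge_min lexx orbT.
exists e; set w' := w + _.
have w'E l : w' l 0 = w l 0 + (if l == i then e else if l == j then - e else 0).
  rewrite !mxE.
  have [->|li] := eqVneq l i; first by rewrite (negPf ij) /=; ring.
  by case: (l == j) => /=; ring.
have w'01 l : 0 <= w' l 0 <= 1.
  rewrite w'E; have /andP[? ?] := w01 l.
  have [->|li] := eqVneq l i; first by apply/andP; split; lra.
  by have [->|lj] := eqVneq l j; apply/andP; split; lra.
split=> //.
  split=> //; rewrite -ws.
  rewrite (bigD1 i) //= (bigD1 j) 1?eq_sym //=.
  rewrite [in RHS](bigD1 i) //= [in RHS](bigD1 j) 1?eq_sym //=.
  rewrite !w'E !eqxx eq_sym (negPf ij).
  rewrite (eq_bigr (fun l => w l 0)); first by ring.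
  by move=> l /andP[/negPf li /negPf lj]; rewrite w'E li lj addr0.
apply: proper_card; apply/andP; split.
  apply/fintype.subsetP => l; rewrite !inE w'E.
  have [->|li] := eqVneq l i; first by rewrite wi0 wi1.
  have [->|lj] := eqVneq l j; first by rewrite wj0 wj1.
  by rewrite addr0.
apply/negP => /fintype.subsetP sub.
have := sub i; have := sub j; rewrite !inE !w'E wi0 wi1 wj0 wj1 eqxx eq_sym.
rewrite (negPf ij) eqxx => /(_ isT)/andP[? ?] /(_ isT)/andP[? ?].
have [? | ?] : e = 1 - w i 0 \/ e = w j 0 by rewrite /e /Num.min; case: ifP; auto.
all: lra.
Qed.

Lemma nonfractional (R : realType) (t : R) :
  0 <= t <= 1 -> ~~ (0 < t < 1) -> t = (t == 1)%:R.
Proof.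
have [->//|t1] := eqVneq t 1; have [->//|t0] := eqVneq t 0.
by rewrite !le_eqVlt eq_sym (negPf t1) (negPf t0) /= => ->.
Qed.

Lemma relaxed_weight_integral (R : realType) (n k : nat) (w : 'cV[R]_n) :
  relaxed_weight k w -> fractional w = finset.set0 ->
  exists2 S : {set 'I_n}, #|S| = k & w = \col_i (i \in S)%:R.
Proof.
move=> [ws w01] w0; exists [set i | w i 0 == 1]%SET; last first.
  apply/matrixP => i j; rewrite ord1 mxE inE.
  have /setP/(_ i) := w0; rewrite !inE.
  by move/negbT; apply: nonfractional (w01 i).
apply/eqP; rewrite -(eqr_nat R) -ws -sum1_card natr_sum big_mkcond /=.
apply/eqP/eq_bigr => i _; rewrite inE.
have /setP/(_ i) := w0; rewrite !inE.
move=> /negbT/(nonfractional (w01 i)) {2}->.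
by case: eqP.
Qed.

(** Integrality of the total weight: if [i] were the only fractional entry, the others would sum to
    a natural number [a] with [a < k < a + 1]. *)
Lemma fractional_pair (R : realType) (n k : nat) (w : 'cV[R]_n) (i : 'I_n) :
  relaxed_weight k w -> i \in fractional w ->
  exists2 j, j \in fractional w & i != j.
Proof.
move=> [ws w01] iw.
have [/existsP[j /andP[jw ij]]|] := boolP [exists j in fractional w, i != j].
  by exists j.
rewrite negb_exists => /forallP H; exfalso.
move: ws; rewrite (bigD1 i) //=.
have -> : \sum_(l | l != i) w l 0 = #|[set l | (l != i) && (w l 0 == 1)]%SET|%:R.
  rewrite -sum1_card natr_sum big_mkcond [in RHS]big_mkcond /=.
  apply: eq_bigr => l _; rewrite inE.
  have [//|li] := eqVneq l i.
  have := H l; rewrite negb_and negbK eq_sym (negPf li) orbF inE /= => wl.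
  by rewrite {1}(nonfractional (w01 l) wl); case: eqP.
set a := #|_|; move: iw; rewrite inE => /andP[wi0 wi1] wa.
have : (a < k)%N by rewrite -(ltr_nat R); lra.
have : (k < a.+1)%N by rewrite -(ltr_nat R) -natr1; lra.
by rewrite ltnS => /leq_ltn_trans/[apply]; rewrite ltnn.
Qed.

(* The weights with entries in {0, 1} are the vertices of the polytope of
   relaxed weights, so a convex function is bounded by its values there. *)
Lemma relaxed_weight_convex (R : realType) (n k : nat) (f : 'cV[R]_n -> R)
    (c : R) :
  (forall a b t, 0 <= t <= 1 ->
    f (t *: a + (1 - t) *: b) <= t * f a + (1 - t) * f b) ->
  (forall S : {set 'I_n}, #|S| = k -> f (\col_i (i \in S)%:R) <= c) ->
  forall w, relaxed_weight k w -> f w <= c.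
Proof.
move=> fconv fS w; have [N] := ubnP #|fractional w|.
elim: N w => // N IH w wN wk.
have [w0|[i iw]] := set_0Vmem (fractional w).
  by have [S Sk ->] := relaxed_weight_integral wk w0; apply: fS.
have [j jw ij] := fractional_pair wk iw.
have [e1 [e10 wk1 wN1]] := relaxed_weight_shift wk iw jw ij.
have [|e2 [e20 wk2 wN2]] := relaxed_weight_shift wk jw iw _.
  by rewrite eq_sym.
have f1 := IH _ (leq_trans wN1 wN) wk1; have f2 := IH _ (leq_trans wN2 wN) wk2.
(* The two shifts go in opposite directions, and this [t] balances them: [t * e1 = (1 - t) * e2], so
   the convex combination gives back [w]. *)
pose t := e2 / (e1 + e2).
have e12 : e1 + e2 != 0 by rewrite gt_eqF // addr_gt0.
have t0 : 0 <= t by rewrite divr_ge0 // ltW // addr_gt0.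
have t1 : t <= 1 by rewrite ler_pdivrMr ?addr_gt0 // mul1r lerDr ltW.
have -> : w = t *: (w + e1 *: exchange R i j)
    + (1 - t) *: (w + e2 *: exchange R j i).
  by apply/matrixP => l l'; rewrite !mxE /t; field.
apply: le_trans (fconv _ _ _ _) _; first by rewrite t0.
nra.
Qed.

(** For fixed [z] the left side is convex in [w], and at the indicator of a [k]-element set the
    Hadamard product is a restriction, hence [k]-sparse. *)
Lemma l2norm_relaxed_weight (R : realType) (m n k : nat) (A : 'M[R]_(m, n))
    (w z : 'cV[R]_n) :
  relaxed_weight k w ->
  l2norm (A *m hadamard w z) <= Num.sqrt (1 + ric A k) * l2norm z.
Proof.
move: w; apply: (relaxed_weight_convex
  (f := fun w => l2norm (A *m hadamard w z))) => [a b t /andP[t0 t1]|S Sk].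
  have -> : hadamard (t *: a + (1 - t) *: b) z
      = t *: hadamard a z + (1 - t) *: hadamard b z.
    by apply/matrixP => i j; rewrite !mxE; ring.
  rewrite mulmxDr -!scalemxAr; apply: le_trans (l2normD _ _) _.
  by rewrite !l2normZ // subr_ge0.
have -> : hadamard (\col_i (i \in S)%:R) z = restr S z.
  apply/matrixP => i j; rewrite !mxE ord1.
  by case: ifP; rewrite ?mul1r ?mul0r.
have Szk : (nnz (restr S z) <= k)%N by rewrite -Sk nnz_restr.
apply: le_trans (ric_ub A Szk) _.
by rewrite ler_wpM2l ?sqrtr_ge0 ?l2norm_restr_le.
Qed.

(** * The block count, the cubic equation and the contraction factor *)

Lemma ceil_ratioP (R : realType) (k q : nat) :
  (1 <= k)%N -> (2 * k <= q)%N ->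
  exists c : nat, [/\ ceil_ratio R q k = c%:R, (2 <= c)%N & (q <= c * k)%N].
Proof.
move=> k1 kq; have k0 : 0 < k%:R :> R by rewrite ltr0n.
have q2 : 2 <= q%:R / k%:R :> R by rewrite ler_pdivlMr // -natrM ler_nat.
have qc : q%:R / k%:R <= ceil_ratio R q k by exact: Num.Theory.ceil_ge.
have : (0 <= Num.ceil (q%:R / k%:R : R))%R.
  by rewrite -(ler_int R); apply: le_trans qc; lra.
move: qc; rewrite /ceil_ratio; case: (Num.ceil _) => // c qc _.
exists c; split=> //; first by rewrite -(ler_nat R); apply: le_trans q2 qc.
by rewrite -(ler_nat R) natrM -ler_pdivrMr.
Qed.

(** Intermediate value theorem: the cubic equals [- kap] at 0 and [2 * a] at 1. *)
Lemma beta_root_exists (R : realType) (a kap : R) : 0 < a -> 0 < kap ->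
  exists2 b : R, 0 < b < 1 & a * b ^+ 3 + a * b ^+ 2 + kap * b - kap = 0.
Proof.
move=> a0 k0.
pose p : {poly R} := a *: 'X^3 + a *: 'X^2 + kap *: 'X - kap%:P.
have pE b : p.[b] = a * b ^+ 3 + a * b ^+ 2 + kap * b - kap.
  by rewrite /p !hornerE.
have [|b /andP[b0 b1]] := @poly_ivt R p 0 1 ler01.
  by rewrite !pE !expr1n !expr0n /= ; apply/andP; split; lra.
rewrite /root pE => /eqP pb; exists b => //.
rewrite !lt_def b0 b1 !andbT; apply/andP; split; apply/eqP => b'.
  by move: pb; rewrite b' !expr0n /=; lra.
by move: pb; rewrite -b' !expr1n; lra.
Qed.

Lemma beta_cubic_strict_mono (R : realType) (a kap s t : R) :
  0 < a -> 0 < kap -> 0 <= s -> s < t ->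
  a * s ^+ 3 + a * s ^+ 2 + kap * s - kap
    < a * t ^+ 3 + a * t ^+ 2 + kap * t - kap.
Proof.
move=> a0 k0 s0 st.
have s3 : s ^+ 3 <= t ^+ 3 by rewrite lerXn2r ?nnegrE //; lra.
have s2 : s ^+ 2 <= t ^+ 2 by rewrite lerXn2r ?nnegrE //; lra.
have := ler_wpM2l (ltW a0) s3; have := ler_wpM2l (ltW a0) s2.
have : kap * s < kap * t by rewrite ltr_pM2l.
lra.
Qed.

(** Identifies the constant of the cubic equation as the inverse fourth power of the golden
    ratio. *)
Lemma golden_pow4 (R : realType) :
  2 / (7 + 3 * Num.sqrt 5) * golden R ^+ 4 = 1 :> R.
Proof.
have g4 : golden R ^+ 4 = (7 + 3 * Num.sqrt 5) / 2.
  have g2 := golden_sqr R.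
  have -> : golden R ^+ 4 = 3 * golden R + 2 by ring: g2.
  by rewrite /golden; field.
have s0 : 0 <= Num.sqrt (5 : R) by exact: sqrtr_ge0.
by rewrite g4; field; lra.
Qed.

Lemma exists_unique_beta_root (R : realType) (q k : nat) :
  0 <= ceil_ratio R q k -> exists! b : R, is_beta_root q k b.
Proof.
move=> c0; have a0 : 0 < 9 * (ceil_ratio R q k + 1) ^+ 2 by nra.
have k0 : 0 < 2 / (7 + 3 * Num.sqrt 5) :> R.
  by rewrite divr_gt0 // ltr_wpDr // mulr_ge0 // sqrtr_ge0.
have [b b01 bE] := beta_root_exists a0 k0; exists b; split=> // b' [b'01 b'E].
have [bb|bb|//] := ltgtP b b'.
- move: b01 => /andP[/ltW b0 _].
  by have := beta_cubic_strict_mono a0 k0 b0 bb; rewrite bE b'E ltxx.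
- move: b'01 => /andP[/ltW b0 _].
  by have := beta_cubic_strict_mono a0 k0 b0 bb; rewrite bE b'E ltxx.
Qed.

Lemma rho_bar_ge0 (R : realType) (m n : nat) (A : 'M[R]_(m, n)) (q k : nat) :
  0 <= ceil_ratio R q k -> 0 <= rho_bar A q k.
Proof.
move=> c0; rewrite /rho_bar !mulr_ge0 ?sqr_ge0 ?sqrtr_ge0 ?ric_ge0 //.
by rewrite addr_ge0.
Qed.

(** Below its root the cubic is negative. Multiplied by [golden R ^+ 4], this bounds the square of
    [rho_bar], once the constants of orders [k] and [2 * k] are replaced by the one of order
    [3 * k]. *)
Lemma rho_bar_lt1 (R : realType) (m n : nat) (A : 'M[R]_(m, n)) (q k : nat)
    (b : R) :
  0 <= ceil_ratio R q k -> is_beta_root q k b -> ric A (3 * k) < b ->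
  rho_bar A q k < 1.
Proof.
move=> c0 [/andP[b0 b1] bE] db.
have d0 := ric_ge0 A (3 * k).
have dk0 := ric_ge0 A k.
have dk : ric A k <= ric A (3 * k) by rewrite ric_mono // leq_pmull.
have d2k : ric A (2 * k) <= ric A (3 * k) by rewrite ric_mono // leq_mul2r orbT.
have a0 : 0 < 9 * (ceil_ratio R q k + 1) ^+ 2 by nra.
have k0 : 0 < 2 / (7 + 3 * Num.sqrt 5) :> R.
  by rewrite divr_gt0 // ltr_wpDr // mulr_ge0 // sqrtr_ge0.
have := beta_cubic_strict_mono a0 k0 d0 db; rewrite bE => H.
have k4 := golden_pow4 R.
rewrite -(@expr_lt1 _ 2) ?rho_bar_ge0 // /rho_bar -/(golden R) exprMn.
rewrite [Num.sqrt (_ / _) ^+ 2]sqr_sqrtr; last by rewrite divr_ge0 //; lra.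
rewrite mulrA ltr_pdivrMr ?mul1r; last lra.
move: k4 k0 H; set kap := 2 / _ => k4 k0.
set c := ceil_ratio R q k in a0 *; set d := ric A (3 * k) in d0 db dk d2k * => H.
have g4 : 0 < golden R ^+ 4 by apply: exprn_gt0; have := golden_gt1 R; lra.
have {}H : golden R ^+ 4 * (9 * (c + 1) ^+ 2) * d ^+ 2 * (1 + d) < 1 - d.
  rewrite -subr_lt0; move: H; rewrite -(pmulr_rlt0 _ g4).
  by congr (_ < 0); ring: k4.
have -> : (3 * golden R ^+ 2 * (c + 1) * d) ^+ 2
    = golden R ^+ 4 * (9 * (c + 1) ^+ 2) * d ^+ 2 by ring.
apply: (le_lt_trans _ (lt_le_trans H _)); last lra.
rewrite ler_wpM2l ?lerD2l // mulr_ge0 ?sqr_ge0 //.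
by rewrite mulr_ge0 // ltW.
Qed.

(** * Error bounds for one iteration *)

(** With [d = xs - xp] the error is the thresholded gradient minus [d], so thresholding is compared
    with a target of at most [2 * k <= q] nonzero entries. The gradient differs from [d] by
    [A^T *m (A *m d) - d] plus the back-projected noise. *)
Lemma gradient_threshold_error (R : realType) (m n k q c : nat)
    (A : 'M[R]_(m, n)) (y : 'cV[R]_m) (xs xp v : 'cV[R]_n) :
  (nnz xs <= k)%N -> (nnz xp <= k)%N -> (2 * k <= q)%N -> (q <= c * k)%N ->
  is_hard_threshold q (A^T *m (y - A *m xp)) v ->
  l2norm (xp + v - xs)
  <= golden R * ((c + 2)%:R * (ric A (3 * k) * l2norm (xp - xs)
                 + Num.sqrt (1 + ric A k) * l2norm (y - A *m xs))).
Proof.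
move=> xsk xpk kq qc [T [Tq top ->]]; set g := A^T *m _ in top *.
pose d := xs - xp; pose D := [set i | d i 0 != 0]%SET.
have Dk : (nnz d <= 2 * k)%N.
  by rewrite mul2n -addnn (leq_trans (nnzB _ _)) // leq_add.
have -> : xp + (\col_i (if i \in T then g i 0 else 0)) - xs = restr T g - d.
  by rewrite -/(restr T g) /d opprB [RHS]addrCA addrA.
have g0 : 0 <= golden R by have := golden_gt1 R; lra.
have dD i : i \notin D -> d i 0 = 0 by rewrite inE negbK => /eqP.
have DT : (#|D| <= #|T|)%N by rewrite Tq (leq_trans Dk).
apply: le_trans (hard_threshold_golden DT top dD) _.
(* The union has at most [q + 2 * k <= (c + 2) * k] indices; a block of size [k] together with the
   support of [d] stays within order [3 * k]. *)
rewrite ler_wpM2l //; apply: (@l2norm_restr_blocks _ _ k) => [B Bk|]; last first.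
  rewrite (leq_trans (leq_card_setU _ _)) // mulnDl leq_add // Tq.
  exact: leq_trans qc _.
have -> : g - d = (A^T *m (A *m d) - d) + A^T *m (y - A *m xs).
  rewrite /g /d !mulmxBr; move: (A^T *m y) (A^T *m (A *m xs)) (A^T *m (A *m xp)).
  by move=> a b e; apply/matrixP => i j; rewrite !mxE; ring.
rewrite restrD; apply: le_trans (l2normD _ _) _; apply: lerD.
  rewrite -(opprB xs) l2normN; apply: l2norm_restr_gram.
  by rewrite (mulnDl 1 2) mul1n leq_add.
exact: l2norm_restr_trmx.
Qed.

(** The product [h] may have a large support, so the lower isometry bound is used only on [Om].
    There the image splits into [eta], the optimal residual and a weighted part of [e]; the residual
    contributes once more [l2norm eta] and a multiple of [l2norm e], whence both factors 2. *)
Lemma relaxed_threshold_error (R : realType) (m n k : nat)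
    (A : 'M[R]_(m, n)) (y : 'cV[R]_m) (xs u w x : 'cV[R]_n) :
  (nnz xs <= k)%N -> (k <= n)%N -> ric A (2 * k) < 1 ->
  is_optimal_weight A y k u w -> is_hard_threshold k (hadamard w u) x ->
  l2norm (x - xs)
  <= golden R / Num.sqrt (1 - ric A (2 * k))
     * (2 * Num.sqrt (1 + ric A k) * l2norm (u - xs)
        + 2 * l2norm (y - A *m xs)).
Proof.
move=> xsk kn d1 [wk wopt] [T [Tk top ->]].
(* A relaxed weight sums to exactly [k], so the support of [xs] is enlarged to exactly [k] indices,
   which fits since [k <= n]. *)
have [|D xsD Dk] := @superset_of_card _ [set i | xs i 0 != 0]%SET k.
  by rewrite card_ord kn andbT.
have xs0 i : i \notin D -> xs i 0 = 0.
  move=> iD; apply/eqP; apply: contraNT iD => xsi.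
  by apply: (fintype.subsetP xsD); rewrite inE.
set h := hadamard w u in top *; set e := u - xs; set eta := y - A *m xs.
have g0 : 0 <= golden R by have := golden_gt1 R; lra.
have s0 : 0 < Num.sqrt (1 - ric A (2 * k)) by rewrite sqrtr_gt0 subr_gt0.
have DT : (#|D| <= #|T|)%N by rewrite Tk Dk.
apply: le_trans (hard_threshold_golden DT top xs0) _.
rewrite -mulrA ler_wpM2l // mulrC ler_pdivlMr // mulrC.
set Om := T :|: D.
have Omk : (nnz (restr Om (h - xs)) <= 2 * k)%N.
  apply: leq_trans (nnz_restr _ _) _.
  by rewrite (leq_trans (leq_card_setU _ _)) // Tk Dk addnn mul2n.
apply: le_trans (ric_lb Omk (ltW d1)) _.
(* The indicator of [D] is the competitor to [w]; it fixes [xs], so its residual is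
   [eta - A *m restr D e]. *)
have wD : relaxed_weight k (\col_i (i \in D)%:R : 'cV[R]_n).
  split; last by move=> i; rewrite mxE; case: (i \in D); rewrite ?lexx ler01.
  rewrite -Dk -sum1_card natr_sum [in RHS]big_mkcond /=.
  by apply: eq_bigr => i _; rewrite mxE; case: (i \in D).
have opt : l2norm (y - A *m h) <= l2norm eta + Num.sqrt (1 + ric A k) * l2norm e.
  have := wopt _ wD; rewrite ler_sqr ?nnegrE ?l2norm_ge0 // => /le_trans -> //.
  have -> : y - A *m hadamard (\col_i (i \in D)%:R) u = eta - A *m restr D e.
    rewrite /eta -addrA -opprD -mulmxDr; congr (y - A *m _).
    apply/matrixP => i j; rewrite !mxE ord1.
    case: (boolP (i \in D)) => iD; first by rewrite mul1r addrC subrK.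
    by rewrite mul0r addr0 xs0.
  have Dk' : (nnz (restr D e) <= k)%N by rewrite -Dk nnz_restr.
  apply: le_trans (l2normB _ _) _; rewrite lerD2l.
  apply: le_trans (ric_ub A Dk') _.
  by rewrite ler_wpM2l ?sqrtr_ge0 ?l2norm_restr_le.
(* Off [Om] the vector [xs] vanishes, so there [h - xs] is [w] times [u - xs]. *)
have -> : A *m restr Om (h - xs)
    = eta - (y - A *m h) - A *m hadamard w (restr (~: Om) e).
  rewrite /eta opprB [_ - _ + _]addrC addrA subrK -!mulmxBr; congr (A *m _).
  apply/matrixP => i j; rewrite !mxE !inE ord1 negb_or.
  have := xs0 i; case: (i \in T); case: (i \in D) => //= xi; try ring.
  by rewrite xi //; ring.
apply: le_trans (l2normB _ _) _.
apply: le_trans (lerD (l2normB _ _) (l2norm_relaxed_weight _ _ wk)) _.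
have := ler_wpM2l (sqrtr_ge0 (1 + ric A k)) (l2norm_restr_le (~: Om) e).
lra.
Qed.

(** Each of the two thresholdings costs one factor [golden R]. The noise entering at the second one
    is amplified only once, which gives the last term of [tau_bar] since
    [Num.sqrt 5 + 1 = 2 * golden R]. *)
Lemma PGROT_step (R : realType) (m n k q : nat) (A : 'M[R]_(m, n))
    (y : 'cV[R]_m) (xs : 'cV[R]_n) (x : nat -> 'cV[R]_n) (p : nat) :
  (1 <= k)%N -> (2 * k <= q)%N -> (q <= n)%N -> (nnz xs <= k)%N ->
  ric A (2 * k) < 1 -> is_PGROT A y k q x ->
  l2norm (x p.+1 - xs)
  <= rho_bar A q k * l2norm (x p - xs) + tau_bar A q k * l2norm (y - A *m xs).
Proof.
move=> k1 kq qn xsk d1 [x0 xS].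
have xpk : (nnz (x p) <= k)%N.
  (* Sparsity of the iterate: the start is 0, and every later iterate is an output of hard
     thresholding of order [k]. *)
  case: p => [|p].
    by rewrite x0 (leq_trans (@nnz_le_card _ _ finset.set0 _ _)) ?cards0 // => i _;
      rewrite mxE.
  by have [v [u [w [_ _ _ [T [<- _ ->]]]]]] := xS p; apply: nnz_restr.
have [v [u [w [vH uE wO xH]]]] := xS p.
have kn : (k <= n)%N by rewrite (leq_trans _ qn) // (leq_trans _ kq) // leq_pmull.
have [c [cE c2 qc]] := ceil_ratioP R k1 kq.
have E1 := gradient_threshold_error xsk xpk kq qc vH.
have := relaxed_threshold_error xsk kn d1 wO xH; rewrite uE.
rewrite /rho_bar /tau_bar cE sqrtrM ?addr_ge0 ?ric_ge0 // sqrtrV ?subr_ge0 ?(ltW d1) //.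
have -> : Num.sqrt 5 + 1 = 2 * golden R by rewrite /golden; field.
have -> : 2 * golden R / 2 = golden R by field.
have s1E : Num.sqrt (1 + ric A k) ^+ 2 = 1 + ric A k.
  by rewrite sqr_sqrtr // addr_ge0 ?ric_ge0.
have s10 := sqrtr_ge0 (1 + ric A k).
have s20 : 0 <= (Num.sqrt (1 - ric A (2 * k)))^-1 by rewrite invr_ge0 sqrtr_ge0.
have g0 : 0 <= golden R by have := golden_gt1 R; lra.
move: E1 s1E s10 s20 g0 (l2norm_ge0 (x p - xs)) (l2norm_ge0 (y - A *m xs)).
move: (l2norm (x p + v - xs)) (l2norm (x p - xs)) (l2norm (y - _)).
move: (Num.sqrt (1 + _)) (Num.sqrt _)^-1 (golden R) (l2norm _).
move: (ric A (3 * k)) (ric_ge0 A (3 * k)).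
move=> d3 d30 s1 s2 g X E D H E1 <- s10 s20 g0 D0 H0 XE.
apply: (le_trans XE); set M := d3 * D + s1 * H in E1.
have M0 : 0 <= M by rewrite addr_ge0 ?mulr_ge0.
have c3 : 2 * (c + 2)%:R <= 3 * (c%:R + 1) :> R.
  have : 2 <= c%:R :> R by rewrite ler_nat.
  by rewrite natrD; lra.
have E2 : 2 * E <= g * (3 * (c%:R + 1) * M).
  apply: (@le_trans _ _ (g * (2 * (c + 2)%:R * M))); first lra.
  by rewrite ler_wpM2l // ler_wpM2r.
have gs : 0 <= g * s2 * s1 by rewrite !mulr_ge0.
have := ler_wpM2l gs E2; rewrite /M; lra.
Qed.

(** * From the one-step contraction to the error bound and convergence *)

(** The bound is the exact solution of the recurrence with equality, whose fixed point is
    [t / (1 - r)], so the induction step closes as an identity. *)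
Lemma affine_recurrence (R : realType) (r t : R) (a : nat -> R) :
  0 <= r < 1 -> (forall p, a p.+1 <= r * a p + t) ->
  forall p, a p <= r ^+ p * (a 0) + t / (1 - r) - r ^+ p * (t / (1 - r)).
Proof.
move=> /andP[r0 r1] aS; elim=> [|p IH]; first by rewrite expr0; lra.
apply: le_trans (aS p) _; apply: le_trans (lerD (ler_wpM2l r0 IH) (lexx t)) _.
by rewrite exprS le_eqVlt; apply/orP; left; apply/eqP; field; lra.
Qed.

(** Convergence of vectors is entrywise uniform, and each entry is bounded by the Euclidean norm. *)
Lemma l2norm_cvg (R : realType) (n : nat) (x : nat -> 'cV[R]_n)
    (l : 'cV[R]_n) :
  (fun p => l2norm (x p - l)) @ \oo --> (0 : R) -> x @ \oo --> l.
Proof.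
move=> H; apply/cvg_ballP => e e0.
have /cvgrPdist_lt/(_ e e0) := H.
apply: filterS => p; rewrite sub0r normrN ger0_norm ?l2norm_ge0 // => pe.
split=> // i j.
rewrite /ball /= distrC; apply: le_lt_trans pe.
rewrite ord1 -ler_sqr ?nnegrE ?l2norm_ge0 // real_normK ?num_real //.
rewrite sqr_l2norm (bigD1 i) //= !mxE lerDl sumr_ge0 // => l' _.
exact: sqr_ge0.
Qed.

Theorem theorem3 (R : realType) (m n : nat) (A : 'M[R]_(m, n)) (y : 'cV[R]_m)
    (k q : nat) (hk : (1 <= k)%N) (hkq : (2 * k <= q)%N) (hqn : (q <= n)%N)
    (xs : 'cV[R]_n) (hxs : is_sparse_ls_solution A y k xs) :
  let eta := y - A *m xs in
  let rho := rho_bar A q k in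
  let tau := tau_bar A q k in
  (exists! b : R, is_beta_root q k b) /\
  forall beta : R, is_beta_root q k beta -> ric A (3 * k) < beta ->
    rho < 1 /\
    forall x : nat -> 'cV[R]_n, is_PGROT A y k q x ->
      (forall p : nat,
         l2norm (x p.+1 - xs)
         <= rho ^+ p * l2norm (x 0%N - xs) + tau / (1 - rho) * l2norm eta) /\
      (eta = 0 -> x @ \oo --> xs).
Proof.
move=> eta rho tau; have [c [cE _ _]] := ceil_ratioP R hk hkq.
have c0 : 0 <= ceil_ratio R q k by rewrite cE.
split=> [|b hb db]; first exact: exists_unique_beta_root.
have r0 : 0 <= rho by exact: rho_bar_ge0.
have r1 : rho < 1 by exact: rho_bar_lt1 hb db.
have r01 : 0 <= rho < 1 by rewrite r0.
split=> // x hx.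
have d2 : ric A (2 * k) < 1.
  have [/andP[_ b1] _] := hb.
  by apply: le_lt_trans (lt_trans db b1); rewrite ric_mono // leq_mul2r orbT.
have step p := PGROT_step p hk hkq hqn hxs.1 d2 hx.
have rec := affine_recurrence r01 step.
have tau0 : 0 <= tau.
  rewrite /tau /tau_bar addr_ge0 ?divr_ge0 ?sqrtr_ge0 ?addr_ge0 ?sqrtr_ge0 //.
  by rewrite !(mulr_ge0, sqr_ge0, invr_ge0, sqrtr_ge0, addr_ge0) ?ric_ge0.
split=> [p|eta0].
  (* The recurrence gives the exponent [p.+1] and a negative noise term; both are weakened to reach
     the stated bound. *)
  apply: le_trans (rec p.+1) _.
  have rp1 : rho ^+ p.+1 <= rho ^+ p by rewrite ler_wiXn2l // ltW.
  have rp0 : 0 <= rho ^+ p.+1 by rewrite exprn_ge0.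
  have t0 : 0 <= tau * l2norm eta / (1 - rho).
    by rewrite divr_ge0 ?mulr_ge0 ?l2norm_ge0 // subr_ge0 ltW.
  have := ler_wpM2r (l2norm_ge0 (x 0%N - xs)) rp1.
  have := mulr_ge0 rp0 t0; rewrite [tau / _ * _]mulrAC -/eta -/rho -/tau; lra.
apply: l2norm_cvg.
(* Without noise only the geometric term survives, and it tends to 0 because [rho < 1]. *)
apply: (@squeeze_cvgr _ _ _ _ (fun=> 0) (fun p => rho ^+ p * l2norm (x 0%N - xs))).
- near=> p; rewrite l2norm_ge0 /=; apply: le_trans (rec p) _.
  by rewrite -/eta eta0 l2norm0 mulr0 mul0r mulr0 subr0 addr0.
- exact: cvg_cst.
rewrite -[X in _ --> X](mul0r (l2norm (x 0%N - xs))).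
by apply: cvgMr_tmp; apply: cvg_expr; rewrite ger0_norm.
Unshelve. all: by end_near.
Qed.
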